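(* Let $n\geq 3$, let $\mathcal K\subseteq\mathbb R^n$ be a proper subdual cone, and let $\mathcal C=\mathbb S^{n-1}\cap\operatorname{int}(\mathcal K)$ and $\overline{\mathcal C}=\mathbb S^{n-1}\cap\mathcal K$. Let $A=A^\top\in\mathbb R^{n\times n}$ have at least two distinct eigenvalues, and let $\{v^1,\dots,v^n\}$ be an orthonormal system of eigenvectors of $A$ corresponding to the eigenvalues $\lambda_1=\dots=\lambda_k<\lambda_{k+1}\leq\dots\leq\lambda_n$, respectively, where $k\geq 1$. Let $q_A(x)=\langle Ax,x\rangle$. Then the following statements hold. (i) If $q_A$ is spherically quasi-convex on $\mathcal C$ and not constant on $\mathcal C$, then $k=1$. (ii) If $q_A$ is spherically quasi-convex on $\mathcal C$ and not constant on $\mathcal C$, then either $\lambda_2\leq\min_{x\in\overline{\mathcal C}}q_A(x)$ or $\max_{x\in\overline{\mathcal C}}q_A(x)\leq\lambda_2$. (iii) Suppose that $k=1$ and $\lambda_2 I_n-A$ is $\mathcal K$-copositive. Then $q_A$ is spherically quasi-convex on $\mathcal C$ if and only if $v^1\in\mathcal W^*\cup(-\mathcal W^* )$. In particular, if $v^1\in\mathcal K^*$, then $q_A$ is spherically quasi-convex on $\mathcal C$. (iv) Suppose that $\mathcal K^*=\mathcal K$ and $v^1\in\mathcal K$. Then $q_A$ is spherically quasi-convex on $\mathcal C$ if and only if $k=1$ and $\lambda_2 I_n-A$ is $\mathcal K$-copositive.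
   Context: $\langle\cdot,\cdot\rangle$ and $\|\cdot\|$ are the canonical inner product and norm of $\mathbb R^n$; $I_n$ is the identity matrix; $\mathbb S^{n-1}=\{x\in\mathbb R^n:\|x\|=1\}$. A cone is a set $\mathcal K\subseteq\mathbb R^n$ with $\alpha x\in\mathcal K$ for all $\alpha>0$, $x\in\mathcal K$. Its dual is $\mathcal K^*=\{x\in\mathbb R^n:\langle x,y\rangle\ge 0\ \forall y\in\mathcal K\}$. A cone is pointed if $\mathcal K\cap(-\mathcal K)\subseteq\{0\}$; proper if it is a pointed closed convex cone with nonempty interior; subdual if $\mathcal K\subseteq\mathcal K^*$. A matrix $M\in\mathbb R^{n\times n}$ is $\mathcal K$-copositive if $\langle Mx,x\rangle\ge 0$ for all $x\in\mathcal K$. The intrinsic distance on the sphere is $d(x,y)=\arccos\langle x,y\rangle$; a geodesic is the intersection of the sphere with a plane through the origin, and a geodesic segment joining $x$ to $y$ is minimal if its length is $d(x,y)$. A set $\mathcal C\subseteq\mathbb S^{n-1}$ is spherically convex if it contains all minimal geodesic segments joining any two of its points (the set $\mathcal C=\mathbb S^{n-1}\cap\operatorname{int}(\mathcal K)$ is spherically convex). A function $f:\mathcal C\to\mathbb R$ on a spherically convex set is spherically quasi-convex if for every minimal geodesic segment $\gamma:I\to\mathcal C$ ($I\subseteq\mathbb R$ an interval), $f(\gamma(t))\le\max\{f(\gamma(t_1)),f(\gamma(t_2))\}$ for all $t\in[t_1,t_2]\subseteq I$. When $k=1$ (so $\lambda_1<\lambda_2\le\dots\le\lambda_n$), put $\theta_i=\frac{\lambda_i-\lambda_2}{\lambda_2-\lambda_1}$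 for $i=2,\dots,n$, $$\mathcal L_{\lambda_2}=\Big\{x\in\mathbb R^n:\langle v^1,x\rangle\ge\sqrt{\theta_2\langle v^2,x\rangle^2+\dots+\theta_n\langle v^n,x\rangle^2}\Big\},\qquad \mathcal W=(\mathcal L_{\lambda_2}\cup-\mathcal L_{\lambda_2})\cap\operatorname{int}(\mathcal K),$$ and $\mathcal W^*=\{x\in\mathbb R^n:\langle x,y\rangle\ge0\ \forall y\in\mathcal W\}$. *)

(* Defs.v *)
From mathcomp Require Import all_boot all_order all_algebra.
From mathcomp Require Import all_classical all_reals all_analysis.

Set Implicit Arguments.
Unset Strict Implicit.
Unset Printing Implicit Defensive.

Import Order.TTheory GRing.Theory Num.Theory.
Import numFieldNormedType.Exports.

Local Open Scope classical_set_scope.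
Local Open Scope ring_scope.

Section Euclidean.
Context {R : realType} {n : nat}.
Implicit Types (x y : 'cV[R]_n) (K : set 'cV[R]_n) (A : 'M[R]_n).

Definition dot x y : R := (x^T *m y) 0 0.

(* The Euclidean unit sphere; the library norm on matrices is the sup norm. *)
Definition sphere : set 'cV[R]_n := [set x | Num.sqrt (dot x x) = 1].

Definition qform A x : R := dot (A *m x) x.

Definition is_cone K := forall (a : R) x, 0 < a -> K x -> K (a *: x).

Definition dual_cone K : set 'cV[R]_n := [set x | forall y, K y -> 0 <= dot x y].

Definition opp_set K : set 'cV[R]_n := [set - x | x in K].

Definition pointed K := K `&` opp_set K `<=` [set 0].

(* [closed] and the interior [K°] refer to the entrywise topology on column
   vectors, which is the Euclidean topology. *)
Definition proper_cone K :=
  [/\ is_cone K, pointed K, closed K, convex_set K & K° !=set0].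

Definition subdual K := K `<=` dual_cone K.

Definition copositive K A := forall x, K x -> 0 <= dot (A *m x) x.

End Euclidean.

Section Extrema.
Context {R : realType}.
Implicit Types (E : set R) (m : R).

Definition is_min E m := E m /\ lbound E m.
Definition is_max E m := E m /\ ubound E m.

End Extrema.

Section Spherical.
Context {R : realType} {n : nat}.
Implicit Types (x y : 'cV[R]_n) (C : set 'cV[R]_n) (gamma : R -> 'cV[R]_n).

Definition sdist x y : R := acos (dot x y).

(* Length of gamma on [a, b] for a <= b: the supremum, over the partitions
   a = t_0 < t_1 < ... < t_k = b, of the sums of the intrinsic distances between
   consecutive points. As in [itv_partition], [s] lists t_1, ..., t_k. *)
Definition curve_length (a b : R) gamma : \bar R :=
  ereal_sup [set (\sum_(0 <= i < size s)
      sdist (gamma (nth b (a :: s) i)) (gamma (nth b (a :: s) i.+1)))%:E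
    | s in itv_partition a b].

Definition geodesic (G : set 'cV[R]_n) :=
  exists2 P : {vspace 'cV[R]_n},
    \dim P = 2%N & G = sphere `&` [set x | x \in P].

(* A curve on the interval I tracing part of a great circle, every compact piece
   of which is as long as the distance between its endpoints. No particular
   parametrization is imposed. When I = [a, b], the last clause for s = a, t = b
   implies all its other instances. *)
Definition minimal_geodesic (I : set R) gamma :=
  [/\ is_interval I,
      {within I, continuous gamma},
      exists2 G, geodesic G & gamma @` I `<=` G
    & forall s t, I s -> I t -> s <= t ->
        curve_length s t gamma = (sdist (gamma s) (gamma t))%:E].

Definition sph_convex C :=
  C `<=` sphere /\
  forall gamma (a b : R), a <= b -> minimal_geodesic `[a, b] gamma ->
    C (gamma a) -> C (gamma b) -> gamma @` `[a, b] `<=` C.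

(* Only the restriction of f to C matters. *)
Definition sph_quasi_convex C (f : 'cV[R]_n -> R) :=
  sph_convex C /\
  forall (I : set R) gamma, minimal_geodesic I gamma -> gamma @` I `<=` C ->
    forall t1 t2 t, I t1 -> I t2 -> t1 <= t <= t2 ->
      f (gamma t) <= Num.max (f (gamma t1)) (f (gamma t2)).

Definition constant_on C (f : 'cV[R]_n -> R) :=
  exists c, forall x, C x -> f x = c.

End Spherical.

Section Spectral.
Context {R : realType} {n : nat}.
Implicit Types (i : 'I_n) (lam : 'I_n -> R) (v : 'I_n -> 'cV[R]_n).

(* Ordinals start at 0: lambda_i and v^i are the values at the ordinal i - 1. *)
Definition idx1 (hn : (2 < n)%N) : 'I_n := Ordinal (ltnW (ltnW hn)).
Definition idx2 (hn : (2 < n)%N) : 'I_n := Ordinal (ltnW hn).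

Definition eigensystem (A : 'M[R]_n) lam v :=
  (forall i, A *m v i = lam i *: v i) /\
  (forall i j, dot (v i) (v j) = (i == j)%:R).

(* lambda_1 = ... = lambda_k < lambda_{k+1} <= ... <= lambda_n *)
Definition spectrum_order (k : nat) lam :=
  [/\ (0 < k < n)%N,
      forall i j : 'I_n, (i < k)%N -> (j < k)%N -> lam i = lam j,
      forall i j : 'I_n, (i < k)%N -> (k <= j)%N -> lam i < lam j
    & forall i j : 'I_n, (k <= i)%N -> (i <= j)%N -> lam i <= lam j].

Definition theta (hn : (2 < n)%N) lam i : R :=
  (lam i - lam (idx2 hn)) / (lam (idx2 hn) - lam (idx1 hn)).

Definition Lcone (hn : (2 < n)%N) lam v : set 'cV[R]_n :=
  [set x | Num.sqrt (\sum_(i < n | (idx2 hn <= i)%N)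
                       theta hn lam i * dot (v i) x ^+ 2)
           <= dot (v (idx1 hn)) x].

Definition Wset (hn : (2 < n)%N) lam v (K : set 'cV[R]_n) : set 'cV[R]_n :=
  (Lcone hn lam v `|` opp_set (Lcone hn lam v)) `&` K°.

End Spectral.

(* Main.v *)
Require Import Defs.
From mathcomp Require Import all_boot all_order all_algebra.
From mathcomp Require Import all_classical all_reals all_analysis.
From mathcomp Require Import ring lra.
Import Order.TTheory GRing.Theory Num.Theory.
Import numFieldNormedType.Exports.
Local Open Scope classical_set_scope.
Local Open Scope ring_scope.

(** Let [R(x) = <Ax,x>/<x,x>] be the Rayleigh quotient. Since [K] is subdual, two
    points of the spherical domain are at distance at most pi/2, and the minimal
    geodesic between them is the arc traced by the nonnegative combinations of
    both. Spherical quasi-convexity of [<Ax,x>] therefore says that all the cones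
    [{x in int K | R(x) <= c}] are convex ([sph_quasi_convexP]), and the rest is
    linear algebra on the open convex cone [int K].

    Suppose these cones are convex and let [R(x) = c] with [x] in [int K]. Moving
    from [x] in opposite directions [h] and [-h] shows that [A - c I] is positive
    semidefinite on the orthogonal of [(A - c I) x]. If [c] exceeded [lambda_2],
    the span of [v^1] and [v^2] would meet this hyperplane in a direction where
    [A - c I] is negative. Hence [R <= lambda_2] on [int K] and then on [K]: this
    is copositivity of [lambda_2 I - A] ([copositive_convex_sublevel]), and it
    gives the bound on the maximum, attained by compactness. If moreover
    [lambda_1 = lambda_2], the form [lambda_2 |x|^2 - <Ax,x>] vanishes on an open
    set, so [A] is scalar; this forces [k = 1] ([lam1_lt_lam2]).

    Conversely, let [lambda_1 < lambda_2] and let [lambda_2 I - A] be copositive.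
    For [c < lambda_2] the set [{R <= c}] is a two-sided quadratic cone around the
    line of [v^1], reduced to 0 if [c < lambda_1], and both halves are convex; so
    the sublevel cones are convex as soon as [int K] lies on one side of the
    hyperplane orthogonal to [v^1] ([convex_sublevel_same_side]). This is also
    necessary: on that hyperplane [R >= lambda_2], while copositivity makes
    [R < lambda_2] at all other points of [int K] ([same_side_convex_sublevel]).
    Copositivity also means that the set W of the statement is all of [int K]
    ([Wset_interior]), so that this condition is [v^1 in W^* or -v^1 in W^*]. It
    holds when [v^1] is in [K^*]. *)

(** * The Euclidean inner product and quadratic forms *)

Section InnerProduct.
Context {R : realType} {n : nat}.
Implicit Types (x y z h w : 'cV[R]_n) (A B : 'M[R]_n) (a b c t : R).

Lemma dotE x y : dot x y = \sum_i x i 0 * y i 0.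
Proof. by rewrite /dot mxE; apply: eq_bigr => i _; rewrite mxE. Qed.

Lemma dotC x y : dot x y = dot y x.
Proof. by rewrite !dotE; apply: eq_bigr => i _; rewrite mulrC. Qed.

Lemma dotDl x y z : dot (x + y) z = dot x z + dot y z.
Proof. by rewrite /dot linearD mulmxDl mxE. Qed.

Lemma dotDr x y z : dot z (x + y) = dot z x + dot z y.
Proof. by rewrite dotC dotDl !(dotC z). Qed.

Lemma dotZl a x y : dot (a *: x) y = a * dot x y.
Proof. by rewrite /dot linearZ -scalemxAl mxE. Qed.

Lemma dotZr a x y : dot x (a *: y) = a * dot x y.
Proof. by rewrite dotC dotZl dotC. Qed.

Lemma dotNl x y : dot (- x) y = - dot x y.
Proof. by rewrite -scaleN1r dotZl mulN1r. Qed.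

Lemma dotNr x y : dot x (- y) = - dot x y.
Proof. by rewrite dotC dotNl dotC. Qed.

Lemma dot0l y : dot 0 y = 0.
Proof. by rewrite -(scale0r (0 : 'cV_n)) dotZl mul0r. Qed.

Definition dotL := (dotDl, dotDr, dotNl, dotNr, dotZl, dotZr).

Lemma dot_ge0 x : 0 <= dot x x.
Proof. by rewrite dotE; apply: sumr_ge0 => i _; exact: sqr_ge0. Qed.

Lemma dot_eq0 x : (dot x x == 0) = (x == 0).
Proof.
apply/idP/eqP => [|->]; last by rewrite dot0l.
rewrite dotE psumr_eq0 => [/allP x0|i _]; last exact: sqr_ge0.
apply/colP => i; have := x0 i; rewrite mem_index_enum => /(_ isT) /=.
by rewrite mulf_eq0 orbb mxE => /eqP.
Qed.

Lemma dot_gt0 x : (0 < dot x x) = (x != 0).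
Proof. by rewrite lt_def dot_ge0 andbT dot_eq0. Qed.

Lemma dot_mulmx_sym A x y : A^T = A -> dot (A *m x) y = dot x (A *m y).
Proof. by move=> AT; rewrite /dot trmx_mul AT mulmxA. Qed.

Lemma qformZ A a x : qform A (a *: x) = a ^+ 2 * qform A x.
Proof. by rewrite /qform -scalemxAr !dotL mulrA. Qed.

Lemma qformD A x y : A^T = A ->
  qform A (x + y) = qform A x + 2 * dot (A *m x) y + qform A y.
Proof.
move=> AT; rewrite /qform mulmxDr !dotL (dot_mulmx_sym A y x AT).
by rewrite (dotC y); ring.
Qed.

Lemma qform_scalarB A a x : qform (a%:M - A) x = a * dot x x - qform A x.
Proof. by rewrite /qform mulmxBl mul_scalar_mx !dotL. Qed.

Lemma unit_dot x : sphere x -> dot x x = 1.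
Proof.
rewrite /sphere /= => sx.
by rewrite -(sqr_sqrtr (dot_ge0 x)) sx expr1n.
Qed.

Lemma dot_unit x : dot x x = 1 -> sphere x.
Proof. by rewrite /sphere /= => ->; rewrite sqrtr1. Qed.

Lemma dot_itv x y : sphere x -> sphere y -> -1 <= dot x y <= 1.
Proof.
move=> /unit_dot xx /unit_dot yy.
have := dot_ge0 (x + y); have := dot_ge0 (x - y).
rewrite !dotL xx yy (dotC y x) => h1 h2; apply/andP; split; lra.
Qed.

End InnerProduct.

(** * Spectral expansions *)

Section Spectrum.
Context {R : realType} {n : nat}.
Variables (A : 'M[R]_n) (lam : 'I_n -> R) (v : 'I_n -> 'cV[R]_n).
Hypothesis eigA : eigensystem A lam v.

Lemma dot_eigen i j : dot (v i) (v j) = (i == j)%:R.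
Proof. by case: eigA. Qed.

(** The matrix whose columns are the [v i] satisfies V^T V = 1, hence also
    V V^T = 1, so passing to the coordinates [dot (v i) x] preserves inner
    products. *)
Lemma parseval x y : dot x y = \sum_i dot (v i) x * dot (v i) y.
Proof.
pose V : 'M[R]_n := \matrix_(i, j) v j i 0.
have VtV : V^T *m V = 1%:M.
  apply/matrixP => i j; rewrite !mxE -dot_eigen dotE.
  by apply: eq_bigr => l _; rewrite !mxE.
have Vx z : V^T *m z = \col_i dot (v i) z.
  apply/colP => i; rewrite !mxE dotE.
  by apply: eq_bigr => l _; rewrite !mxE.
have -> : dot x y = dot (V^T *m x) (V^T *m y).
  by rewrite /dot trmx_mul trmxK mulmxA -(mulmxA _ V) (mulmx1C VtV) mulmx1.
by rewrite dotE !Vx; apply: eq_bigr => i _; rewrite !mxE.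
Qed.

Hypothesis symA : A^T = A.

Lemma dot_eigen_mul i x : dot (v i) (A *m x) = lam i * dot (v i) x.
Proof. by rewrite -dot_mulmx_sym// (proj1 eigA) dotZl. Qed.

Lemma qform_spectral x : qform A x = \sum_i lam i * dot (v i) x ^+ 2.
Proof.
rewrite /qform parseval; apply: eq_bigr => i _.
by rewrite dot_eigen_mul; ring.
Qed.

(** A Rayleigh quotient is a weighted mean of the eigenvalues, and only those
    whose eigenvector is not orthogonal to [x] have a nonzero weight. *)
Lemma qform_ge_spectral a x :
  (forall i, dot (v i) x != 0 -> a <= lam i) -> a * dot x x <= qform A x.
Proof.
move=> ale; rewrite qform_spectral parseval mulr_sumr; apply: ler_sum => i _.
rewrite -expr2; have [->|/ale] := eqVneq (dot (v i) x) 0.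
  by rewrite expr0n /= !mulr0.
by move/ler_wpM2r; apply; exact: sqr_ge0.
Qed.

End Spectrum.

(** * Interior of a proper cone *)

Lemma quadratic_neg_near0 {R : realType} (b c e a : R) : 0 < e -> a < 0 ->
  exists2 t, 0 < t < e & a + b * t + c * t ^+ 2 < 0.
Proof.
move=> e0 a0; pose f t := a + b * t + c * t ^+ 2.
have fc : {for 0, continuous f}.
  apply: cvgD; first apply: cvgD; first exact: cvg_cst.
    by apply: cvgM; [exact: cvg_cst|exact: cvg_id].
  by apply: cvgM; [exact: cvg_cst|exact: exprn_continuous].
have f0 : f 0 < 0 by rewrite /f mulr0 expr0n mulr0 !addr0.
have := fc _ (lt_nbhsl f0).
move=> /nbhs_ballP[d d0 fd]; exists (Num.min d e / 2).
  rewrite divr_gt0 ?lt_min ?d0//= ltr_pdivrMr// mulr_natr mulr2n -[ltLHS]addr0.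
  by rewrite ler_ltD// ge_min lexx orbT.
apply: fd; rewrite /ball /= sub0r normrN ger0_norm; last first.
  by rewrite divr_ge0// le_min !ltW.
by rewrite ltr_pdivrMr// mulr_natr mulr2n -[ltLHS]addr0 ler_ltD// ge_min lexx.
Qed.

Section ConeInterior.
Context {R : realType} {n : nat}.
Implicit Types (x y z h w : 'cV[R]_n) (M : 'M[R]_n) (a b c s t : R).
Variable K : set 'cV[R]_n.
Hypothesis properK : proper_cone K.

Lemma coneD x y : K x -> K y -> K (x + y).
Proof.
case: properK => cone _ _ cvx _ Kx Ky.
have half0 : 0 <= 2^-1 :> R by lra.
have half1 : 2^-1 <= 1 :> R by lra.
have := set_mem (cvx x y (Itv01 half0 half1) (mem_set Kx) (mem_set Ky)).
rewrite /conv /= => Kxy.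
have := cone 2 _ (ltr0n _ 2) Kxy.
rewrite scalerDr !scalerA /unstable.onem.
have -> : 1 - 2^-1 = 2^-1 :> R by lra.
by rewrite mulfV ?scale1r// pnatr_eq0.
Qed.

(** The affine contraction [z |-> a^-1 (z - y)] sends [a x + y] to [x], and a
    convex cone contains every point whose image lies in it. *)
Lemma interior_coneDl x y a : K° x -> K y -> 0 < a -> K° (a *: x + y).
Proof.
move=> ix Ky a0; have a_neq0 : a != 0 by rewrite gt_eqF.
pose g z := a^-1 *: (z - y).
have gx : g (a *: x + y) = x by rewrite /g addrK scalerA mulVf// scale1r.
have gc : {for a *: x + y, continuous g}.
  apply: continuousZ; first exact: cst_continuous.
  by apply: continuousB => //; exact: (@cst_continuous _ _ y).
have nK : nbhs (a *: x + y) (g @^-1` K) by apply: gc; rewrite gx.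
apply: (@filterS _ (nbhs (a *: x + y)) _ _ _ _ nK) => z /=.
case: properK => cone _ _ _ _ Kgz.
have -> : z = a *: g z + y by rewrite scalerA mulfV// scale1r subrK.
exact: coneD (cone _ _ a0 Kgz) Ky.
Qed.

Lemma interior_coneZ x a : K° x -> 0 < a -> K° (a *: x).
Proof.
move=> ix a0; have -> : a *: x = (a / 2) *: x + (a / 2) *: x.
  by rewrite -scalerDl -splitr.
have a20 : 0 < a / 2 by rewrite divr_gt0.
apply: interior_coneDl => //; case: properK => cone _ _ _ _.
by apply: cone => //; exact: interior_subset.
Qed.

Lemma interior_coneD x y : K° x -> K° y -> K° (x + y).
Proof.
move=> ix iy; rewrite -[x]scale1r.
exact: interior_coneDl ix (interior_subset iy) ltr01.
Qed.

Lemma interior_cone_comb x y a b : K° x -> K° y -> 0 <= a -> 0 <= b ->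
  0 < a + b -> K° (a *: x + b *: y).
Proof.
move=> ix iy; rewrite !le_eqVlt => /predU1P[<-|a0] /predU1P[<-|b0].
- by rewrite addr0 ltxx.
- by move=> _; rewrite scale0r add0r; exact: interior_coneZ.
- by move=> _; rewrite scale0r addr0; exact: interior_coneZ.
- by move=> _; apply: interior_coneD; exact: interior_coneZ.
Qed.

Lemma interior_segment x h : K° x ->
  exists2 e, 0 < e & forall t, `|t| < e -> K° (x + t *: h).
Proof.
move=> ix.
have gc : {for 0, continuous (fun t : R => x + t *: h)}.
  apply: continuousD; last exact: scalel_continuous.
  exact: (@cst_continuous _ _ x).
have := gc K°; rewrite scale0r addr0 => /(_ (nbhs_interior ix)).
move=> /nbhs_ballP[e e0 ball_e]; exists e => // t te.
by apply: ball_e; rewrite /ball /= sub0r normrN.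
Qed.

(** If 0 were interior, the cone would contain a vector and its opposite. *)
Lemma interior_cone_neq0 x : (0 < n)%N -> K° x -> x != 0.
Proof.
move=> n0 ix; apply/eqP => x0; rewrite x0 in ix.
pose h : 'cV[R]_n := const_mx 1.
have [e e0 Ke] := interior_segment _ h ix.
have e2 : `|e / 2| < e by rewrite ger0_norm; lra.
have := Ke (e / 2) e2; have := Ke (- (e / 2)); rewrite normrN.
move=> /(_ e2) /interior_subset Kn /interior_subset Kp.
rewrite add0r in Kp; rewrite add0r scaleNr in Kn.
have : [set 0] ((e / 2) *: h).
  case: properK => _ pt _ _ _; apply: pt; split => //.
  by exists (- ((e / 2) *: h)) => //; rewrite opprK.
move=> /colP /(_ (Ordinal n0)); rewrite !mxE mulr1; lra.
Qed.

(** Every point of [K] is the limit of the interior points [t e + x], with [e]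
    interior and [t > 0] tending to 0; along this half-line the form is a
    quadratic polynomial in [t], so a negative value at [x] would persist. *)
Lemma copositive_interior M : M^T = M ->
  (forall x, K° x -> 0 <= qform M x) -> copositive K M.
Proof.
move=> MT Mpos x Kx; rewrite -/(qform M x) leNgt; apply/negP => Mx.
have [e ie] : K° !=set0 by case: properK.
have pos t : 0 < t -> 0 <= qform M x + 2 * dot (M *m x) e * t
    + qform M e * t ^+ 2.
  move=> t0; have := Mpos _ (interior_coneDl _ _ _ ie Kx t0).
  rewrite addrC qformD// qformZ dotZr => h; apply: le_trans h _.
  by rewrite le_eqVlt; apply/orP; left; apply/eqP; ring.
have [t /andP[t0 _]] :=
  quadratic_neg_near0 (2 * dot (M *m x) e) (qform M e) 1 _ ltr01 Mx.
by rewrite ltNge pos.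
Qed.

(** An interior zero of a form that is nonnegative on [K] is a local minimum, so
    the gradient [2 M x] of the form vanishes there. *)
Lemma interior_zero_copositive M x : M^T = M -> copositive K M ->
  K° x -> qform M x = 0 -> M *m x = 0.
Proof.
move=> MT Mpos ix Mx; apply/eqP; rewrite -dot_eq0.
set p := dot _ _; have [//|p_neq0] := eqVneq p 0.
have p0 : 0 < p by rewrite lt_def p_neq0 dot_ge0.
(* against the gradient, the form decreases at first order if M x != 0 *)
have [e e0 Ke] := interior_segment _ (- (M *m x)) ix.
have p2 : - (2 * p) < 0 by lra.
have [t /andP[t0 te]] :=
  quadratic_neg_near0 (qform M (- (M *m x))) 0 e _ e0 p2.
rewrite mul0r addr0 => neg.
have /Mpos : K (x + t *: - (M *m x)).
  by apply: interior_subset; apply: Ke; rewrite gtr0_norm.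
rewrite -/(qform M _) qformD// Mx qformZ !dotL -/p => ge0.
have : t * (- (2 * p) + qform M (- (M *m x)) * t) < 0 by rewrite pmulr_rlt0.
lra.
Qed.

End ConeInterior.

(** * Minimal geodesics of the sphere *)

Section MinimalGeodesics.
Context {R : realType} {n : nat}.
Implicit Types (x y z h w : 'cV[R]_n) (a b c s t : R) (gamma : R -> 'cV[R]_n).

(** The length of a curve is at least the sum attached to the subdivision at the
    single intermediate parameter [t]. *)
Lemma minimal_geodesic_sdistD (I : set R) gamma s t u :
  minimal_geodesic I gamma -> I s -> I u -> s < t < u ->
  sdist (gamma s) (gamma t) + sdist (gamma t) (gamma u)
    <= sdist (gamma s) (gamma u).
Proof.
case=> _ _ _ min_gamma Is Iu /andP[st tu].
rewrite -lee_fin -min_gamma ?(ltW (lt_trans st tu))//.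
apply: ereal_sup_ubound; exists [:: t; u].
  by rewrite /itv_partition /= st tu eqxx.
by rewrite /= big_nat_recr//= big_nat1.
Qed.

Lemma minimal_geodesic_sphere (I : set R) gamma s :
  minimal_geodesic I gamma -> I s -> sphere (gamma s).
Proof.
case=> _ _ [G [P _ ->] sub] _ Is.
by have [] := sub _ (imageP gamma Is).
Qed.

(** Equality case of the triangle inequality on the sphere. With al and be the
    angles from [z] to [x] and to [y], spherical trigonometry predicts
    [sin be x + sin al y = sin (al + be) z]. The squared norm of the difference
    of the two sides equals [2 sin al sin be (dot x y - cos (al + be))], which the
    hypothesis on distances makes nonpositive. The assumption [0 <= dot x y]
    keeps [al + be] away from pi, so one can divide by [sin (al + be)] unless
    both angles vanish. *)
Lemma sdist_between x y z : sphere x -> sphere y -> sphere z ->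
  0 <= dot x y -> sdist x z + sdist z y <= sdist x y ->
  exists a b, [/\ 0 <= a, 0 <= b, 0 < a + b & z = a *: x + b *: y].
Proof.
move=> sx sy sz xy0.
have xz := dot_itv x z sx sz; have zy := dot_itv z y sz sy.
have xyI := dot_itv x y sx sy.
rewrite /sdist; set al := acos (dot x z); set be := acos (dot z y).
set th := acos (dot x y) => le_th.
have al0 : 0 <= al by exact: acos_ge0.
have be0 : 0 <= be by exact: acos_ge0.
have th_pi : th <= pi by exact: acos_lepi.
have cos_al : cos al = dot x z by apply: acosK; rewrite in_itv.
have cos_be : cos be = dot z y by apply: acosK; rewrite in_itv.
have cos_th : cos th = dot x y by apply: acosK; rewrite in_itv.
have al_pi : al <= pi by exact: acos_lepi.
have be_pi : be <= pi by exact: acos_lepi.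
have cos_le : cos th <= cos (al + be).
  rewrite leNgt ltr_cos ?in_itv/= ?addr_ge0 ?(le_trans le_th)//.
    by rewrite -leNgt.
  by rewrite acos_ge0.
have sal : 0 <= sin al by rewrite sin_ge0_pi// al0.
have sbe : 0 <= sin be by rewrite sin_ge0_pi// be0.
have := cos2Dsin2 al; have := cos2Dsin2 be.
move: cos_le; rewrite cosD cos_al cos_be cos_th.
move: sal sbe; set s1 := sin al; set s2 := sin be => s10 s20 cos_le e2 e1.
have [[xx yy] zz] := (unit_dot x sx, unit_dot y sy, unit_dot z sz).
set c := s1 * dot z y + dot x z * s2.
have cE : c = sin (al + be) by rewrite sinD cos_al cos_be.
have eqz : s2 *: x + s1 *: y = c *: z.
  apply/eqP; rewrite -subr_eq0 -dot_eq0 eq_le dot_ge0 andbT.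
  rewrite !dotL xx yy zz (dotC y x) (dotC z x) (dotC y z).
  rewrite /c; move: e1 e2 cos_le; set a := dot x z; set b := dot z y.
  set d := dot x y => e1 e2 cos_le.
  have ss : 0 <= s1 * s2 by exact: mulr_ge0.
  have : 0 <= (s1 * s2) * (a * b - s1 * s2 - d).
    by rewrite mulr_ge0// subr_ge0.
  have E1 : a ^+ 2 = 1 - s1 ^+ 2 by rewrite -e1 addrK.
  have E2 : b ^+ 2 = 1 - s2 ^+ 2 by rewrite -e2 addrK.
  set L := (X in X <= 0).
  have -> : L = s1 ^+ 2 + s2 ^+ 2 + 2 * (s1 * s2) * d
      - (s1 ^+ 2 * b ^+ 2 + a ^+ 2 * s2 ^+ 2 + 2 * (s1 * s2) * (a * b)).
    by rewrite /L; ring.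
  by rewrite E1 E2; nra.
have [c0|c0] := ltP 0 c.
  exists (s2 / c), (s1 / c); split.
  - by rewrite divr_ge0// ltW.
  - by rewrite divr_ge0// ltW.
  - rewrite -mulrDl divr_gt0// lt_def addr_ge0// andbT.
    apply/eqP => s12; have [s10' s20'] : s1 = 0 /\ s2 = 0 by split; lra.
    by move: c0; rewrite /c s10' s20' mul0r mulr0 addr0 ltxx.
  - rewrite !(mulrC _ c^-1) -!scalerA -scalerDr eqz scalerA mulVf ?gt_eqF//.
    by rewrite scale1r.
(* here sin (al + be) = 0, which forces al = be = 0 and z = x *)
exists 1, 0; split; rewrite ?addr0 ?ler01 ?ltr01 ?scale1r ?scale0r ?lexx //.
have ab0 : al + be = 0.
  apply/eqP; rewrite eq_le addr_ge0// andbT leNgt; apply/negP => ab0.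
  have : 0 < c.
    rewrite cE sin_gt0_pi// ab0 /=; apply: (le_lt_trans le_th).
    by rewrite /th acos_ltpi//; apply/andP; split; lra.
  by rewrite ltNge c0.
have al_0 : al = 0 by lra.
have xz1 : dot x z = 1 by rewrite -cos_al al_0 cos0.
rewrite addr0; apply/esym/eqP; rewrite -subr_eq0 -dot_eq0.
by rewrite !dotL xx zz (dotC z x) xz1; apply/eqP; ring.
Qed.

Definition great_arc x w t := cos t *: x + sin t *: w.

Section GreatArc.
Variables x w : 'cV[R]_n.
Hypotheses (xx : dot x x = 1) (ww : dot w w = 1) (xw : dot x w = 0).

Lemma dot_great_arc s t : dot (great_arc x w s) (great_arc x w t) = cos (t - s).
Proof. by rewrite /great_arc !dotL xx ww (dotC w x) xw cosB; ring. Qed.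

Lemma sphere_great_arc t : sphere (great_arc x w t).
Proof. by apply: dot_unit; rewrite dot_great_arc subrr cos0. Qed.

Lemma sdist_great_arc s t : 0 <= t - s <= pi ->
  sdist (great_arc x w s) (great_arc x w t) = t - s.
Proof. by move=> st; rewrite /sdist dot_great_arc cosK// in_itv. Qed.

Lemma continuous_great_arc : continuous (great_arc x w).
Proof.
move=> t.
apply: (@continuousD _ _ _ (fun t => cos t *: x) (fun t => sin t *: w)).
  by apply: continuousZ; [exact: continuous_cos|exact: (@cst_continuous _ _ x)].
by apply: continuousZ; [exact: continuous_sin|exact: (@cst_continuous _ _ w)].
Qed.

(** Distances along the arc are differences of parameters, so the sum attached
    to any subdivision telescopes. *)
Lemma curve_length_great_arc s t : 0 <= s -> s <= t -> t <= pi ->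
  curve_length s t (great_arc x w) = (t - s)%:E.
Proof.
move=> s0 st tpi; rewrite -[RHS]ereal_sup1; congr ereal_sup.
have sumE r : itv_partition s t r -> \sum_(0 <= i < size r)
    sdist (great_arc x w (nth t (s :: r) i))
          (great_arc x w (nth t (s :: r) i.+1)) = t - s.
  move=> part.
  have -> : t - s = nth t (s :: r) (size r) - nth t (s :: r) 0.
    by rewrite (itv_partition_nth_size t part).
  rewrite -(telescope_sumr (nth t (s :: r)))//; apply: eq_big_nat => i /= ir.
  have ir2 : (i < (size r).+1)%N by exact: ltnW.
  have le_i : nth t (s :: r) i <= nth t (s :: r) i.+1.
    by case: part => + _; move=> /(pathP t) /(_ _ ir) /ltW.
  have ge_s := itv_partition_nth_ge ir2 part.
  have le_t := itv_partition_nth_le (m := i.+1) ir part.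
  by rewrite sdist_great_arc// subr_ge0 le_i /=; move: ge_s le_t => /=; lra.
apply/seteqP; split => [_ [r part <-]|_ ->] /=; first by rewrite sumE.
have [sltt|] := ltP s t; last first.
  move=> ts; have -> : s = t by apply/eqP; rewrite eq_le st.
  by exists [::]; [rewrite /itv_partition /=|rewrite big_nil subrr].
by exists [:: t]; [exact: itv_partition1|rewrite sumE//; exact: itv_partition1].
Qed.

Lemma minimal_great_arc th : 0 <= th <= pi ->
  minimal_geodesic `[0, th] (great_arc x w).
Proof.
move=> /andP[th0 thpi]; split.
- exact: interval_is_interval.
- exact/continuous_subspaceT/continuous_great_arc.
- exists (sphere `&` [set z | z \in <<[:: x; w]>>%VS]).
    exists <<[:: x; w]>>%VS => //; apply/eqP.
    rewrite (_ : 2%N = size [:: x; w])// -/(free _) free_cons seq1_free.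
    rewrite -dot_eq0 ww oner_eq0 andbT span_seq1; apply/negP => /vlineP[k xk].
    by move: xx; rewrite {2}xk dotZr xw mulr0 => /eqP; rewrite eq_sym oner_eq0.
  move=> _ [t _ <-]; split; first exact: sphere_great_arc.
  by rewrite /= /great_arc rpredD// rpredZ// memv_span// !inE eqxx ?orbT.
- move=> s t; rewrite /= !in_itv /= => /andP[s0 _] /andP[_ tth] st.
  have tpi : t <= pi := le_trans tth thpi.
  by rewrite curve_length_great_arc// sdist_great_arc//; apply/andP; split; lra.
Qed.

End GreatArc.

(** The vector [w] is the unit tangent at [x] in the direction of [y]. *)
Lemma great_arc_join x y : sphere x -> sphere y -> dot x y < 1 ->
  0 <= dot x y -> exists w th,
  [/\ dot w w = 1, dot x w = 0, 0 <= th <= pi, 0 < sin th & 0 <= cos th] /\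
  great_arc x w th = y.
Proof.
move=> sx sy xy1 xy0; have xyI := dot_itv x y sx sy.
have [xx yy] := (unit_dot x sx, unit_dot y sy).
pose th := acos (dot x y).
have cosE : cos th = dot x y by apply: acosK; rewrite in_itv.
have th0 : 0 < th by apply: acos_gt0; rewrite xy1 andbT; lra.
have thpi : th < pi by apply: acos_ltpi; apply/andP; split; lra.
have s0 : 0 < sin th by rewrite sin_gt0_pi// th0.
have s_neq0 : sin th != 0 by rewrite gt_eqF.
exists ((sin th)^-1 *: (y - cos th *: x)), th; split; last first.
  by rewrite /great_arc scalerA mulfV// scale1r addrC subrK.
split => //; last by rewrite cosE.
- rewrite !dotL xx yy (dotC y x) -cosE.
  transitivity ((sin th)^-1 ^+ 2 * (1 - cos th ^+ 2)); first by ring.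
  by rewrite -sin2cos2 -exprMn mulVf// expr1n.
- by rewrite !dotL xx -cosE mulr1 subrr mulr0.
- by rewrite !ltW.
Qed.

Section ArcSegment.
Variables (x w : 'cV[R]_n) (th : R).
Hypotheses (xx : dot x x = 1) (ww : dot w w = 1) (xw : dot x w = 0).
Hypotheses (th_itv : 0 <= th <= pi) (sin_th : 0 < sin th).

(** The parameter is [acos p], where [p = dot x z]. It does not exceed [th]
    because [z] is at least as close to [x] as the endpoint of the arc is: its
    coefficients are nonnegative and, [z] being a unit vector, add up to at
    least 1. *)
Lemma great_arc_reach a b : 0 <= cos th -> 0 <= a -> 0 <= b ->
  let z := a *: x + b *: great_arc x w th in
  dot z z = 1 -> exists2 t, 0 <= t <= th & great_arc x w t = z.
Proof.
move=> cos_th a0 b0 z zz; have c2s2 := cos2Dsin2 th.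
have zE : z = (a + b * cos th) *: x + (b * sin th) *: w.
  by rewrite /z /great_arc scalerDr !scalerA addrA -scalerDl.
have p2r2 : (a + b * cos th) ^+ 2 + (b * sin th) ^+ 2 = 1.
  by rewrite -zz zE !dotL xx ww (dotC w x) xw; ring.
have ab1 : 1 <= a + b.
  have cos1 := cos_le1 th.
  have ab : a * b * cos th <= a * b by rewrite ler_piMr// mulr_ge0.
  have : 1 = a ^+ 2 + 2 * (a * b * cos th)
      + b ^+ 2 * (cos th ^+ 2 + sin th ^+ 2).
    by rewrite -[LHS]p2r2; ring.
  rewrite c2s2 leNgt => e; apply/negP => ab1; nra.
have p_ge : cos th <= a + b * cos th.
  have cos1 := cos_le1 th.
  have [b1|b1] := leP 1 b; first nra.
  have : (1 - b) * cos th <= 1 - b by rewrite ler_piMr//; lra.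
  nra.
set p := a + b * cos th in zE p2r2 p_ge; set r := b * sin th in zE p2r2.
have r0 : 0 <= r by rewrite mulr_ge0// ltW.
have pI : -1 <= p <= 1 by apply/andP; split; nra.
have cos_p : cos (acos p) = p by apply: acosK; rewrite in_itv.
exists (acos p); last first.
  rewrite /great_arc cos_p sin_acos// -p2r2 addrAC subrr add0r sqrtr_sqr.
  by rewrite ger0_norm.
rewrite acos_ge0//= leNgt -ltr_cos ?in_itv/= ?acos_ge0 ?acos_lepi//.
by rewrite cos_p -leNgt.
Qed.

Lemma great_arc_comb t : 0 <= t <= th -> exists a b,
  [/\ 0 <= a, 0 <= b, 0 < a + b &
      great_arc x w t = a *: x + b *: great_arc x w th].
Proof.
move=> /andP[t0 tth]; have /andP[th0 thpi] := th_itv.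
have s_neq0 : sin th != 0 by rewrite gt_eqF.
pose a := sin (th - t) / sin th; pose b := sin t / sin th.
have a0 : 0 <= a.
  apply: divr_ge0; last exact: ltW.
  by apply: sin_ge0_pi; apply/andP; split; lra.
have b0 : 0 <= b.
  apply: divr_ge0; last exact: ltW.
  by apply: sin_ge0_pi; apply/andP; split; lra.
have arcE : great_arc x w t = a *: x + b *: great_arc x w th.
  rewrite /great_arc scalerDr !scalerA addrA -scalerDl /a /b divfK//.
  congr (_ *: _ + _); rewrite sinB.
  have -> : (sin th * cos t - cos th * sin t) / sin th + sin t / sin th * cos th
    = sin th * cos t / sin th by ring.
  by rewrite mulrAC mulfV// mul1r.
exists a, b; split => //; rewrite lt_def addr_ge0// andbT paddr_eq0//.
apply/negP => /andP[/eqP a_eq0 /eqP b_eq0].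
have := dot_great_arc x w xx ww xw t t.
by rewrite arcE a_eq0 b_eq0 !scale0r addr0 dot0l subrr cos0 => /eqP;
  rewrite eq_sym oner_eq0.
Qed.

End ArcSegment.

End MinimalGeodesics.

(** * Quasi-convexity and convex sublevel cones *)

Section SublevelCones.
Context {R : realType} {n : nat}.
Implicit Types (x y z h w : 'cV[R]_n) (A : 'M[R]_n) (a b c s t : R).

(** For each level [c], the set of the [x] in [D] with [<Ax,x> <= c <x,x>] is
    invariant under positive scaling when [D] is a cone, so stability under
    addition is exactly its convexity. *)
Definition convex_sublevel_cones (D : set 'cV[R]_n) A :=
  forall c x y, D x -> D y -> qform A x <= c * dot x x ->
    qform A y <= c * dot y y -> qform A (x + y) <= c * dot (x + y) (x + y).

Variable K : set 'cV[R]_n.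
Hypotheses (n_gt0 : (0 < n)%N) (properK : proper_cone K) (subdualK : subdual K).

Let C := sphere `&` K°.

Lemma interior_dot_ge0 x y : K° x -> K° y -> 0 <= dot x y.
Proof.
by move=> /interior_subset/subdualK Kx /interior_subset Ky; exact: Kx.
Qed.

(** Distances add up along a minimal geodesic, and the equality case of the
    triangle inequality then puts [gamma t] in the cone spanned by the
    endpoints. *)
Lemma minimal_geodesic_comb (I : set R) gamma s t u :
  minimal_geodesic I gamma -> I s -> I u -> s <= t <= u ->
  K° (gamma s) -> K° (gamma u) -> exists a b,
  [/\ 0 <= a, 0 <= b, 0 < a + b & gamma t = a *: gamma s + b *: gamma u].
Proof.
move=> geo Is Iu /andP[]; rewrite le_eqVlt => /predU1P[<- _ _ _|st].
  by exists 1, 0; rewrite scale1r scale0r !addr0 ler01 lexx ltr01.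
rewrite le_eqVlt => /predU1P[-> _ _|tu Ks Ku].
  by exists 0, 1; rewrite scale1r scale0r !add0r ler01 lexx ltr01.
have stu : s < t < u by rewrite st.
have It : I t.
  by case: geo => itvI _ _ _; apply: (itvI s u) => //; rewrite !ltW.
apply: sdist_between; try exact: minimal_geodesic_sphere geo _.
  exact: interior_dot_ge0.
exact: minimal_geodesic_sdistD geo Is Iu stu.
Qed.

Lemma sph_convex_interior : sph_convex C.
Proof.
split=> [x []//|gamma a b ab geo [_ Ka] [_ Kb] _ [t tab <-]].
have [Ia Ib] : `[a, b]%classic a /\ `[a, b]%classic b.
  by rewrite /= !in_itv/= !lexx ab.
split; first exact: minimal_geodesic_sphere geo tab.
move: tab; rewrite /= in_itv/= => tab.
have [c [d [c0 d0 cd ->]]] :=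
  minimal_geodesic_comb _ _ _ _ _ geo Ia Ib tab Ka Kb.
exact: interior_cone_comb.
Qed.

Variable A : 'M[R]_n.

Lemma convex_sublevel_comb c x y a b : convex_sublevel_cones K° A ->
  K° x -> K° y -> 0 <= a -> 0 <= b ->
  qform A x <= c * dot x x -> qform A y <= c * dot y y ->
  let z := a *: x + b *: y in qform A z <= c * dot z z.
Proof.
move=> cvx Kx Ky a0 b0 qx qy.
have scale u e : qform A u <= c * dot u u ->
    qform A (e *: u) <= c * dot (e *: u) (e *: u).
  move=> qu; rewrite qformZ !dotL.
  rewrite (_ : c * _ = e ^+ 2 * (c * dot u u)); last by ring.
  by rewrite ler_wpM2l// sqr_ge0.
move: a0 b0; rewrite !le_eqVlt => /predU1P[<-|a0] /predU1P[<-|b0] /=.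
- by rewrite !scale0r addr0 -(scale0r x); exact: scale.
- by rewrite scale0r add0r; exact: scale.
- by rewrite scale0r addr0; exact: scale.
- apply: cvx; [exact: interior_coneZ|exact: interior_coneZ| |]; exact: scale.
Qed.

(** Spherical quasi-convexity of a quadratic form is convexity of its sublevel
    cones. From right to left, a point of a minimal geodesic is a nonnegative
    combination of the endpoints. From left to right, the direction of [x + y]
    lies on the great arc joining the directions of [x] and [y], and this arc is
    a minimal geodesic that stays in the interior of the cone. *)
Lemma sph_quasi_convexP :
  sph_quasi_convex C (qform A) <-> convex_sublevel_cones K° A.
Proof.
split=> [[_ qcA] c x y Kx Ky qx qy|cvx]; last first.
  split=> [|I gamma geo subC t1 t2 t It1 It2 tt].
    exact: sph_convex_interior.
  have [sx Kx] := subC _ (imageP gamma It1).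
  have [sy Ky] := subC _ (imageP gamma It2).
  have [a [b [a0 b0 ab tE]]] :=
    minimal_geodesic_comb _ _ _ _ _ geo It1 It2 tt Kx Ky.
  have It : I t by case: geo => itvI _ _ _; exact: (itvI t1 t2).
  have := unit_dot _ (minimal_geodesic_sphere _ _ _ geo It).
  rewrite tE => zz; set m := Num.max _ _.
  rewrite -[leRHS]mulr1 -[X in m * X]zz; apply: convex_sublevel_comb => //.
    by rewrite (unit_dot _ sx) mulr1 /m le_max lexx.
  by rewrite (unit_dot _ sy) mulr1 /m le_max lexx orbT.
pose N (u : 'cV[R]_n) : R := Num.sqrt (dot u u).
have N_gt0 u : K° u -> 0 < N u.
  by move=> Ku; rewrite sqrtr_gt0 dot_gt0; exact: interior_cone_neq0 Ku.
pose nrm (u : 'cV[R]_n) := (N u)^-1 *: u.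
have nrmK u : K° u -> u = N u *: nrm u.
  by move=> Ku; rewrite scalerA mulfV ?scale1r// gt_eqF// N_gt0.
have N2 u : N u ^+ 2 = dot u u by rewrite sqr_sqrtr// dot_ge0.
have nrm_unit u : K° u -> dot (nrm u) (nrm u) = 1.
  move=> Ku; rewrite !dotL -N2 mulrA -expr2 -exprMn mulVf ?expr1n//.
  by rewrite gt_eqF// N_gt0.
have nrmC u : K° u -> C (nrm u).
  move=> Ku; split; first exact/dot_unit/nrm_unit.
  by apply: interior_coneZ => //; rewrite invr_gt0 N_gt0.
have q_nrm u : K° u -> (qform A u <= c * dot u u) = (qform A (nrm u) <= c).
  move=> Ku; rewrite {1}(nrmK u Ku) qformZ -N2 mulrC ler_pM2r//.
  by rewrite exprn_gt0 ?N_gt0.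
have nrmE u : nrm u = (N u)^-1 *: u by [].
clearbody nrm N.
have Kxy : K° (x + y) by exact: interior_coneD.
rewrite (q_nrm _ Kx) in qx; rewrite (q_nrm _ Ky) in qy; rewrite (q_nrm _ Kxy).
have [sx Kx'] := nrmC _ Kx; have [sy Ky'] := nrmC _ Ky.
have zE : nrm (x + y) = (N x / N (x + y)) *: nrm x + (N y / N (x + y)) *: nrm y.
  by rewrite !(mulrC _ (N (x + y))^-1) -!scalerA -!nrmK// -scalerDr nrmE.
have [a0 b0] : 0 <= N x / N (x + y) /\ 0 <= N y / N (x + y).
  by split; apply: divr_ge0; apply/ltW/N_gt0.
have zz := nrm_unit _ Kxy; rewrite zE in zz *.
move: (N x / _) (N y / _) a0 b0 zz => a b a0 b0 zz.
(* no great circle is determined when x and y have the same direction *)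
have /andP[_] := dot_itv _ _ sx sy; rewrite le_eqVlt => /predU1P[xy1|xy_lt1].
  have yE : nrm y = nrm x.
    apply/eqP; rewrite -subr_eq0 -dot_eq0 !dotL (nrm_unit x)// (nrm_unit y)//.
    by rewrite (dotC (nrm y)) xy1; apply/eqP; ring.
  move: zz; rewrite yE -scalerDl qformZ !dotL (nrm_unit x)// mulr1 -expr2 => ->.
  by rewrite mul1r.
have [w [th [[ww xw thI sin_th cos_th] yE]]] :=
  great_arc_join _ _ sx sy xy_lt1 (interior_dot_ge0 _ _ Kx' Ky').
have xx := nrm_unit _ Kx; rewrite -yE in zz *.
have [t tI <-] := great_arc_reach _ _ _ xx ww xw thI sin_th a b cos_th a0 b0 zz.
have geo := minimal_great_arc _ _ xx ww xw th thI.
have arc0 : great_arc (nrm x) w 0 = nrm x.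
  by rewrite /great_arc cos0 sin0 scale1r scale0r addr0.
have subC : great_arc (nrm x) w @` `[0, th] `<=` C.
  move=> _ [u uI <-]; move: uI; rewrite /= in_itv/= => uI.
  split; first exact: sphere_great_arc.
  have [d [e [d0 e0 de ->]]] := great_arc_comb _ _ _ xx ww xw thI sin_th u uI.
  by rewrite yE; exact: interior_cone_comb.
have /andP[th0 _] := thI.
have := qcA _ _ geo subC 0 th t; rewrite /= !in_itv/= !lexx th0.
move=> /(_ isT isT tI) /le_trans; apply.
by rewrite arc0 yE ge_max qx.
Qed.

End SublevelCones.

(** * Maximum of a quadratic form on a spherical cap *)

Section Extrema.
Context {R : realType} {n : nat}.
Implicit Types (A : 'M[R]_n) (K : set 'cV[R]_n).

Lemma continuous_qform A : continuous (qform A).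
Proof.
have -> : qform A = (fun x : 'cV[R]_n => \sum_i (\sum_j A i j * x j 0) * x i 0).
  apply/funext => x; rewrite /qform dotE.
  by apply: eq_bigr => i _; rewrite mxE.
apply: continuous_big => [|i _]; first exact: add_continuous.
move=> x; apply: continuousM; last exact: coord_continuous.
move: x; apply: continuous_big => [|j _]; first exact: add_continuous.
move=> x; apply: continuousM; last exact: coord_continuous.
exact: (@cst_continuous _ _ (A i j)).
Qed.

Lemma continuous_trmx (m p : nat) : continuous (@trmx R m p).
Proof.
move=> x P [Q Qx QP]; exists (fun i j => Q j i) => [i j|y yQ].
  by have := Qx j i; rewrite mxE.
by apply: QP => i j; rewrite mxE.
Qed.

(** The sphere is bounded for the sup norm; transposition brings the question to
    row vectors, where bounded closed sets are compact. *)
Lemma compact_sphere_cap K : closed K -> compact (sphere `&` K).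
Proof.
move=> clK.
have -> : sphere `&` K = (@trmx R 1 n) @` ((@trmx R 1 n) @^-1` (sphere `&` K)).
  apply/seteqP; split => [x [sx Kx]|_ [r /= rS <-]//].
  by exists x^T; rewrite /= trmxK.
apply: continuous_compact; first exact/continuous_subspaceT/continuous_trmx.
apply: bounded_closed_compact.
  exists 1; split => // M M1 r [/unit_dot rr _].
  change (mx_norm r <= M); rewrite mx_normrE; apply: bigmax_le => [|[i j] _ /=].
    by rewrite ltW// (lt_trans _ M1).
  apply: le_trans (ltW M1); rewrite ord1 -(@expr_le1 _ 2)// -normrX.
  rewrite ger0_norm ?sqr_ge0//.
  rewrite -rr dotE (bigD1 j)//= !mxE -expr2 lerDl.
  by apply: sumr_ge0 => l _; rewrite mxE -expr2 sqr_ge0.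
apply: preimage_closed => [x _|]; first exact: continuous_trmx.
apply: closedI => //.
have -> : sphere = (qform 1%:M) @^-1` [set x : R | x = 1] :> set 'cV[R]_n.
  apply/seteqP; split => x; rewrite /= /qform mul1mx; first exact: unit_dot.
  exact: dot_unit.
apply: preimage_closed => [x _|]; first exact: continuous_qform.
exact: closed_eq.
Qed.

Lemma qform_max_cap K A : closed K -> sphere `&` K !=set0 ->
  exists2 x, (sphere `&` K) x &
    forall y, (sphere `&` K) y -> qform A y <= qform A x.
Proof.
move=> clK K0.
have [|x] := compact_EVT_max K0 (compact_sphere_cap K clK) (f := qform A).
  exact/continuous_subspaceT/continuous_qform.
rewrite inE => Kx maxx; exists x => // y Ky.
by apply: maxx; rewrite inE.
Qed.

End Extrema.

(** * Convex sublevel cones and eigenvalues *)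

Section QuasiConvexQuadraticForms.
Context {R : realType} {n : nat}.
Implicit Types (x y z h w : 'cV[R]_n) (i j : 'I_n) (a b c s t : R).
Variables (K : set 'cV[R]_n) (A : 'M[R]_n).
Hypotheses (n_gt0 : (0 < n)%N) (properK : proper_cone K) (symA : A^T = A).

(** The level can be lowered to the larger of the two Rayleigh quotients, so
    strict inequalities are preserved as well. *)
Lemma convex_sublevel_lt c x y : convex_sublevel_cones K° A ->
  K° x -> K° y -> qform A x < c * dot x x -> qform A y < c * dot y y ->
  qform A (x + y) < c * dot (x + y) (x + y).
Proof.
move=> cvx Kx Ky qx qy.
have pos u : K° u -> 0 < dot u u.
  by move=> Ku; rewrite dot_gt0; exact: interior_cone_neq0 Ku.
pose rq u := qform A u / dot u u; pose m := Num.max (rq x) (rq y).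
have mc : m < c by rewrite gt_max /rq !ltr_pdivrMr ?pos// qx.
have mle u : K° u -> rq u <= m -> qform A u <= m * dot u u.
  by move=> Ku; rewrite /rq ler_pdivrMr// pos.
have /(_ (mle _ Kx _) (mle _ Ky _)) := cvx m _ _ Kx Ky.
rewrite !le_max !lexx orbT => /(_ isT isT) /le_lt_trans; apply.
by rewrite ltr_pM2r// pos//; exact: interior_coneD.
Qed.

(** Second-order condition at an interior point [x] with Rayleigh quotient [c].
    With [B = A - c I], a direction [h] orthogonal to [B x] along which [B] is
    negative would give points [x + t h] and [x - t h] with Rayleigh quotients
    below [c], although their midpoint [x] has Rayleigh quotient [c]. *)
Lemma convex_sublevel_psd_orth c x h : convex_sublevel_cones K° A ->
  K° x -> qform A x = c * dot x x -> dot (A *m x) h = c * dot x h ->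
  c * dot h h <= qform A h.
Proof.
move=> cvx Kx qx xh; rewrite leNgt; apply/negP => qh.
have [e e0 Ke] := interior_segment K x h Kx.
pose t := e / 2; have t0 : 0 < t by rewrite divr_gt0.
have te : `|t| < e by rewrite gtr0_norm// /t; lra.
have Kp := Ke t te; have := Ke (- t); rewrite normrN => /(_ te) Km.
have neg s : s ^+ 2 = t ^+ 2 ->
    qform A (x + s *: h) < c * dot (x + s *: h) (x + s *: h).
  move=> ss; rewrite qformD// qformZ !dotL qx xh (dotC h x) ss -subr_gt0.
  set r := (X in 0 < X).
  have -> : r = t ^+ 2 * (c * dot h h - qform A h) by rewrite /r -ss; ring.
  by rewrite mulr_gt0 ?exprn_gt0// subr_gt0.
have := convex_sublevel_lt _ _ _ cvx Kp Km (neg t erefl) (neg (- t) (sqrrN t)).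
have -> : x + t *: h + (x + - t *: h) = 2 *: x.
  by rewrite addrACA -scalerDl subrr scale0r addr0 scaler_nat mulr2n.
by rewrite qformZ !dotL qx; lra.
Qed.

Variables (lam : 'I_n -> R) (v : 'I_n -> 'cV[R]_n) (i1 i2 : 'I_n).
Hypotheses (eigA : eigensystem A lam v) (i12 : i1 != i2).
Hypotheses (lam12 : lam i1 <= lam i2).
Hypotheses (lam2_le : forall i, i != i1 -> lam i2 <= lam i).

Let M : 'M[R]_n := (lam i2)%:M - A.

Lemma sym_shift : M^T = M.
Proof. by rewrite /M linearB /= tr_scalar_mx symA. Qed.

(** If some interior [x] had a Rayleigh quotient [c] above [lam i2], then
    [B = A - c I] would be negative definite on the plane spanned by [v i1] and
    [v i2]. This plane contains a nonzero [h] orthogonal to [B x], against the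
    second-order condition. *)
Lemma copositive_convex_sublevel :
  convex_sublevel_cones K° A -> copositive K M.
Proof.
move=> cvx; apply: (copositive_interior K properK _ sym_shift) => x Kx.
rewrite /M qform_scalarB subr_ge0 leNgt; apply/negP => lt_q.
have xx : 0 < dot x x by rewrite dot_gt0; exact: interior_cone_neq0 Kx.
pose c := qform A x / dot x x.
have qx : qform A x = c * dot x x by rewrite /c divfK// gt_eqF.
have c2 : lam i2 < c by rewrite ltr_pdivlMr.
have c1 : lam i1 < c by exact: le_lt_trans c2.
(* coefficients of h; if B x has no component along v i1, then h = v i1 works *)
have [a [b [ab0 ab]]] : exists a b, 0 < a ^+ 2 + b ^+ 2 /\
    a * ((lam i1 - c) * dot (v i1) x) + b * ((lam i2 - c) * dot (v i2) x) = 0.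
  set p := (lam i1 - c) * _; set r := (lam i2 - c) * _.
  have [p0|p0] := eqVneq p 0.
    by exists 1, 0; rewrite p0 expr1n expr0n addr0 ltr01 mulr0 mul0r addr0.
  exists r, (- p); split; last by ring.
  by rewrite sqrrN ltr_wpDl ?sqr_ge0// lt_def sqrf_eq0 p0 sqr_ge0.
pose h := a *: v i1 + b *: v i2.
have hh : dot h h = a ^+ 2 + b ^+ 2.
  rewrite /h !dotL !(dot_eigen A lam v eigA) !eqxx (eq_sym i2) (negbTE i12) /=.
  by ring.
have qh : qform A h = lam i1 * a ^+ 2 + lam i2 * b ^+ 2.
  rewrite /qform /h mulmxDr -!scalemxAr !(proj1 eigA) !dotL.
  rewrite !(dot_eigen A lam v eigA) !eqxx (eq_sym i2) (negbTE i12) /=.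
  by ring.
have xh : dot (A *m x) h = c * dot x h.
  rewrite (dotC _ h) (dotC x) /h !dotL !(dot_eigen_mul A lam v eigA symA).
  by apply/eqP; rewrite -subr_eq0; apply/eqP; rewrite -[RHS]ab; ring.
have := convex_sublevel_psd_orth c x h cvx Kx qx xh.
rewrite hh qh.
have : 0 < (c - lam i2) * (a ^+ 2 + b ^+ 2) by rewrite mulr_gt0// subr_gt0.
have : 0 <= (lam i2 - lam i1) * a ^+ 2 by rewrite mulr_ge0 ?sqr_ge0// subr_ge0.
lra.
Qed.

(** If the two smallest eigenvalues were equal, [M] would be at once copositive
    and negative semidefinite, so it would vanish on the open set [K°], that
    is, everywhere; but [M] does not kill [v j]. *)
Lemma lam1_lt_lam2 : (exists j, lam i2 < lam j) ->
  convex_sublevel_cones K° A -> lam i1 < lam i2.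
Proof.
move=> [j ltj] /copositive_convex_sublevel cop.
rewrite lt_neqAle lam12 andbT; apply/eqP => lamE.
have M0 x : K° x -> M *m x = 0.
  move=> Kx; apply: (interior_zero_copositive K M _ sym_shift cop Kx).
  apply/eqP; rewrite eq_le (cop x (interior_subset Kx)) andbT.
  rewrite /M qform_scalarB subr_le0.
  apply: (qform_ge_spectral A lam v eigA symA) => i _.
  by have [->|/lam2_le] := eqVneq i i1; rewrite ?lamE.
have [x Kx] : K° !=set0 by case: properK.
have [e e0 Ke] := interior_segment K x (v j) Kx.
have e2 : `|e / 2| < e by rewrite ger0_norm; lra.
have := M0 _ (Ke _ e2); rewrite mulmxDr (M0 x Kx) add0r -scalemxAr => /eqP.
rewrite scaler_eq0 gt_eqF ?divr_gt0//= => /eqP Mv.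
have : dot (M *m v j) (v j) = lam i2 - lam j.
  rewrite /M mulmxBl mul_scalar_mx (proj1 eigA) !dotL (dot_eigen A lam v eigA).
  by rewrite eqxx !mulr1.
by rewrite Mv dot0l; lra.
Qed.

(** At a level [c >= lam i2] copositivity makes the sublevel cone all of [K°]. At
    a lower level, [B = A - c I] is positive definite on the hyperplane
    orthogonal to [v i1], so the sublevel set is a two-sided quadratic cone
    around the axis [v i1], and [x] and [y] lie in the same convex half. This is
    obtained by evaluating [B] at the combination [w] of [x] and [y] orthogonal
    to [v i1], whose coefficients have opposite signs: [<Bw,w> >= 0] bounds the
    cross term [<Bx,y>]. *)
Lemma convex_sublevel_same_side : copositive K M ->
  (forall x y, K° x -> K° y -> 0 <= dot (v i1) x * dot (v i1) y) ->
  convex_sublevel_cones K° A.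
Proof.
move=> cop side c x y Kx Ky qx qy.
have [c2|c2] := leP (lam i2) c.
  have := cop _ (interior_subset (interior_coneD K properK x y Kx Ky)).
  rewrite -/(qform M _) /M qform_scalarB subr_ge0 => /le_trans; apply.
  by rewrite ler_wpM2r// dot_ge0.
have orth w : dot (v i1) w = 0 -> lam i2 * dot w w <= qform A w.
  move=> vw; apply: (qform_ge_spectral A lam v eigA symA) => i viw.
  by apply: lam2_le; apply: contra_neq viw => ->.
have neq0 z : K° z -> qform A z <= c * dot z z -> dot (v i1) z != 0.
  move=> Kz qz; apply/eqP => /orth /le_trans /(_ qz).
  by rewrite ler_pM2r ?leNgt ?c2// dot_gt0; exact: interior_cone_neq0 Kz.
have := side x y Kx Ky; have := neq0 y Ky qy; have := neq0 x Kx qx.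
have := orth (dot (v i1) y *: x + (- dot (v i1) x) *: y).
rewrite (qformD A (_ *: x))// !dotL.
move: (dot (v i1) x) (dot (v i1) y) => p r.
rewrite !qformZ -scalemxAr !dotL => /(_ ltac:(ring)) le_orth p0 r0.
rewrite le_eqVlt eq_sym mulf_eq0 (negbTE p0) (negbTE r0) /= => pr.
rewrite qformD// (dotC y x).
have dw := dot_ge0 (r *: x + (- p) *: y).
move: le_orth dw; rewrite !dotL (dotC y x).
move: (dot (A *m x) y) (dot x y) (qform A x) (qform A y) qx qy.
move: (dot x x) (dot y y) => X Y Q D qX qY qx qy le_orth dw.
have : c * (r ^+ 2 * X - 2 * (p * r) * D + p ^+ 2 * Y)
   <= r ^+ 2 * qX - 2 * (p * r) * Q + p ^+ 2 * qY.
  have : c * (r ^+ 2 * X - 2 * (p * r) * D + p ^+ 2 * Y)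
    <= lam i2 * (r ^+ 2 * X - 2 * (p * r) * D + p ^+ 2 * Y).
    by apply: ler_wpM2r; [lra|exact: ltW].
  lra.
have := ler_wpM2l (sqr_ge0 r) qx; have := ler_wpM2l (sqr_ge0 p) qy.
move=> hy hx hw.
have : p * r * (Q - c * D) <= 0 by lra.
rewrite pmulr_rle0// subr_le0; lra.
Qed.

(** If [v i1] took both signs on [K°], some positive combination of two interior
    points on opposite sides would be orthogonal to [v i1], hence have Rayleigh
    quotient at least [lam i2]. Both points have a Rayleigh quotient strictly
    below [lam i2]: with equality, the point would be an interior zero of the
    copositive form [M], hence in the kernel of [M], which is orthogonal to
    [v i1]. *)
Lemma same_side_convex_sublevel x y : lam i1 < lam i2 ->
  convex_sublevel_cones K° A -> K° x -> K° y ->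
  0 <= dot (v i1) x * dot (v i1) y.
Proof.
move=> lt12 cvx; have cop := copositive_convex_sublevel cvx.
wlog xy : x y / dot (v i1) x <= dot (v i1) y.
  by move=> W Kx Ky; case/orP: (le_total (dot (v i1) x) (dot (v i1) y)) => xy;
    [|rewrite mulrC]; exact: W.
move=> Kx Ky; rewrite leNgt; apply/negP => neg.
have x0 : dot (v i1) x < 0 by nra.
have y0 : 0 < dot (v i1) y by nra.
have lt_lam2 z : K° z -> dot (v i1) z != 0 -> qform A z < lam i2 * dot z z.
  move=> Kz z0; rewrite lt_neqAle -subr_ge0 -qform_scalarB.
  rewrite (cop z (interior_subset Kz)) andbT; apply/eqP => qz.
  have Mz : M *m z = 0.
    apply: (interior_zero_copositive K M z sym_shift cop Kz).
    by rewrite /M qform_scalarB qz subrr.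
  have : dot (v i1) (M *m z) = 0 by rewrite Mz dotC dot0l.
  rewrite /M mulmxBl mul_scalar_mx !dotL (dot_eigen_mul A lam v eigA symA).
  rewrite -mulrBl => /eqP.
  by rewrite mulf_eq0 subr_eq0 gt_eqF// (negbTE z0).
(* the positive combination of x and y orthogonal to v i1 *)
pose x' := dot (v i1) y *: x; pose y' := - dot (v i1) x *: y.
have Kx' : K° x' by exact: interior_coneZ.
have Ky' : K° y' by apply: interior_coneZ; rewrite // oppr_gt0.
have qx' : qform A x' < lam i2 * dot x' x'.
  apply: lt_lam2 => //; rewrite dotZr; apply: mulf_neq0.
    by rewrite gt_eqF.
  by rewrite lt_eqF.
have qy' : qform A y' < lam i2 * dot y' y'.
  apply: lt_lam2 => //; rewrite dotZr; apply: mulf_neq0.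
    by rewrite oppr_eq0 lt_eqF.
  by rewrite gt_eqF.
have := convex_sublevel_lt _ _ _ cvx Kx' Ky' qx' qy'.
apply/negP; rewrite -leNgt.
apply: (qform_ge_spectral A lam v eigA symA) => i vi.
apply: lam2_le; apply: contra_neq vi => ->.
by rewrite /x' /y' !dotL; ring.
Qed.

End QuasiConvexQuadraticForms.

(** * Quasi-convexity criteria on subdual cones *)

(** In the eigenbasis, membership of [x] in the union of the two opposite cones
    reads [<(lam2 I - A) x, x> >= 0], after division by [lam2 - lam1]. *)
Lemma Wset_interior (R : realType) (n : nat) (hn : (2 < n)%N)
    (K : set 'cV[R]_n) (A : 'M[R]_n) (lam : 'I_n -> R) (v : 'I_n -> 'cV[R]_n) :
  A^T = A -> eigensystem A lam v -> lam (idx1 hn) < lam (idx2 hn) ->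
  copositive K ((lam (idx2 hn))%:M - A) -> Wset hn lam v K = K°.
Proof.
move=> symA eigA lt12 cop; apply/seteqP; split => [x []//|x Kx]; split=> //.
set i1 := idx1 hn in lt12 *; set i2 := idx2 hn in lt12 cop *.
set T := fun z => \sum_(i < n | (i2 <= i)%N) theta hn lam i * dot (v i) z ^+ 2.
have Tx : T x <= dot (v i1) x ^+ 2.
  have gap : 0 < lam i2 - lam i1 by rewrite subr_gt0.
  have := cop x (interior_subset Kx); rewrite -/(qform _ x) qform_scalarB.
  rewrite (qform_spectral A lam v eigA symA) (parseval A lam v eigA).
  rewrite mulr_sumr -sumrB (bigD1 i1)//= => sum_ge0.
  rewrite -(ler_pM2l gap) -subr_ge0; apply: le_trans sum_ge0 _.
  rewrite le_eqVlt; apply/orP; left; apply/eqP.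
  rewrite /T mulr_sumr -sumrN; congr (_ + _); first by ring.
  rewrite (eq_bigl (fun i : 'I_n => (i2 <= i)%N)) => [|i].
    apply: eq_bigr => i _; rewrite /theta -/i1 -/i2 !mulrA mulrC.
    have -> : (lam i2 - lam i1) * (lam i - lam i2) / (lam i2 - lam i1)
        = lam i - lam i2 by rewrite mulrAC mulfV ?mul1r// gt_eqF.
    by ring.
  by rewrite -val_eqE /= lt0n.
have sqrtT z : T z <= dot (v i1) z ^+ 2 -> 0 <= dot (v i1) z ->
    Lcone hn lam v z.
  move=> Tz z0; rewrite /Lcone /= -(ger0_norm z0) -sqrtr_sqr.
  exact: ler_wsqrtr.
have [x0|x0] := leP 0 (dot (v i1) x); first by left; exact: sqrtT.
right; exists (- x); last by rewrite opprK.
apply: sqrtT; last by rewrite dotNr oppr_ge0 ltW.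
rewrite dotNr sqrrN (_ : T (- x) = T x)//.
by apply: eq_bigr => i _; rewrite dotNr sqrrN.
Qed.

Theorem theorem2 (R : realType) (n : nat) (hn : (2 < n)%N)
  (K : set 'cV[R]_n) (A : 'M[R]_n) (k : nat)
  (lam : 'I_n -> R) (v : 'I_n -> 'cV[R]_n) :
  proper_cone K -> subdual K ->
  A^T = A ->
  (exists a b : R, [/\ a != b, eigenvalue A a & eigenvalue A b]) ->
  eigensystem A lam v ->
  spectrum_order k lam ->
  let C := sphere `&` K° in
  let Cbar := sphere `&` K in
  let q := qform A in
  let v1 := v (idx1 hn) in
  let lam2 := lam (idx2 hn) in
  let Wdual := dual_cone (Wset hn lam v K) in
  [/\ (* (i) *)
      sph_quasi_convex C q -> ~ constant_on C q -> k = 1%N,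
      (* (ii) *)
      sph_quasi_convex C q -> ~ constant_on C q ->
        (exists2 m, is_min (q @` Cbar) m & lam2 <= m) \/
        (exists2 M, is_max (q @` Cbar) M & M <= lam2),
      (* (iii) *)
      k = 1%N -> copositive K (lam2%:M - A) ->
        (sph_quasi_convex C q <-> (Wdual `|` opp_set Wdual) v1) /\
        (dual_cone K v1 -> sph_quasi_convex C q)
    & (* (iv) *)
      dual_cone K = K -> K v1 ->
        (sph_quasi_convex C q <-> k = 1%N /\ copositive K (lam2%:M - A))].
Proof.
move=> properK subdualK symA _ eigA [kn lamk lamkk lam_mono].
move=> C Cbar q v1 lam2 Wdual.
have n0 : (0 < n)%N by exact: (ltn_trans _ hn).
pose i1 := idx1 hn; pose i2 := idx2 hn.
have /andP[k0 ltkn] := kn.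
have i12 : i1 != i2 by rewrite -val_eqE.
have lam2_le i : i != i1 -> lam i2 <= lam i.
  rewrite -val_eqE /= -lt0n => i_gt0.
  have [k2|k2] := ltnP 1 k; last by apply: lam_mono.
  have [ik|ki] := ltnP i k; first by rewrite (lamk i2 i).
  exact/ltW/lamkk.
have lam12 : lam i1 <= lam i2.
  have [k2|k2] := ltnP 1 k; first by rewrite (lamk i1 i2).
  exact/ltW/lamkk.
have qcP : sph_quasi_convex C q <-> convex_sublevel_cones K° A.
  exact: sph_quasi_convexP.
have cop_qc : sph_quasi_convex C q -> copositive K (lam2%:M - A).
  move=> /qcP.
  exact: (copositive_convex_sublevel K A n0 properK symA lam v i1 i2).
have k1_lt : k = 1%N -> lam i1 < lam i2 by move=> k1; apply: lamkk; rewrite k1.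
have k1 : sph_quasi_convex C q -> k = 1%N.
  move=> /qcP cvx; apply/eqP; rewrite eqn_leq k0 andbT leqNgt; apply/negP => k2.
  have lt2 : lam i2 < lam (Ordinal ltkn) by exact: lamkk.
  have := lam1_lt_lam2 K A n0 properK symA lam v i1 i2 eigA i12 lam12 lam2_le.
  move=> /(_ (ex_intro _ (Ordinal ltkn) lt2) cvx).
  by rewrite (lamk i1 i2) ?ltxx.
have same_side_qc : copositive K (lam2%:M - A) ->
    (forall x y, K° x -> K° y -> 0 <= dot v1 x * dot v1 y) ->
    sph_quasi_convex C q.
  move=> cop side; apply/qcP.
  exact: (convex_sublevel_same_side K A n0 properK symA lam v i1 i2).
have dual_qc : copositive K (lam2%:M - A) -> dual_cone K v1 ->
    sph_quasi_convex C q.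
  move=> cop dualv; apply: same_side_qc => // x y Kx Ky.
  by apply: mulr_ge0; apply: dualv; exact: interior_subset.
split.
- by move=> /k1.
- move=> qc _; right; have clK : closed K by case: properK.
  have [e Ke] : K° !=set0 by case: properK.
  have e_gt0 : 0 < Num.sqrt (dot e e).
    by rewrite sqrtr_gt0 dot_gt0; exact: interior_cone_neq0 Ke.
  have [|x [sx Kx] maxx] := qform_max_cap K A clK.
    exists ((Num.sqrt (dot e e))^-1 *: e); split.
      apply: dot_unit; rewrite !dotL -[X in _ * (_ * X)]sqr_sqrtr ?dot_ge0//.
      by rewrite mulrA -expr2 -exprMn mulVf ?expr1n// gt_eqF.
    apply: interior_subset; apply: interior_coneZ => //.
    by rewrite invr_gt0.
  exists (q x); first split.
  + by exists x.
  + by move=> _ [y Cy <-]; exact: maxx.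
  + have := cop_qc qc x Kx.
    by rewrite -/(qform _ x) qform_scalarB (unit_dot _ sx) mulr1 subr_ge0.
- move=> k_eq1 cop; have lt12 := k1_lt k_eq1.
  have WE : Wset hn lam v K = K° by exact: Wset_interior cop.
  split; last exact: dual_qc.
  rewrite /Wdual WE; split => [qc|W].
    have side x y := same_side_convex_sublevel K A n0 properK symA lam v i1 i2
      eigA i12 lam12 lam2_le x y lt12 (proj1 qcP qc).
    have [nonneg|neg] := pselect (forall x, K° x -> 0 <= dot v1 x).
      by left.
    have [x Kx x0] : exists2 x, K° x & dot v1 x < 0.
      apply: contrapT => no_neg; apply: neg => x Kx.
      by rewrite leNgt; apply/negP => x0; apply: no_neg; exists x.
    right; exists (- v1); last by rewrite opprK.
    move=> y Ky; rewrite dotNl oppr_ge0.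
    by rewrite -(nmulr_rge0 _ x0); exact: side.
  apply: same_side_qc => // x y Kx Ky.
  case: W => [W|[u W <-]]; first by apply: mulr_ge0; exact: W.
  by rewrite !dotNl mulrNN; apply: mulr_ge0; exact: W.
- move=> dualE Kv1; split => [qc|[_ cop]].
    by split; [exact: k1|exact: cop_qc].
  by apply: dual_qc => //; rewrite dualE.
Qed.
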